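(* Let $\{x_k\}_{k\ge 0}$ be the sequence of random iterates generated by the MSKM algorithm (defined in the context) from a starting point $x_0\in\mathbb{R}^n$, with parameters $0<\delta<2$ and $0\le\gamma<1$ satisfying $$0\le\gamma<\frac{1-\sqrt{h(\delta)}}{1-\sqrt{h(\delta)}+\delta\sqrt{\mu_2}} .$$ Put $\Pi_1=\sqrt{h(\delta)}$, $\Pi_2=\Pi_4=\gamma$, $\Pi_3=\delta\sqrt{\mu_2}$, $D=(\Pi_1-\Pi_4)^2+4\Pi_2\Pi_3$, and $$\Gamma_1=\frac{\Pi_1-\Pi_4+\sqrt{D}}{2\Pi_3},\quad \Gamma_2=\frac{\Pi_1-\Pi_4-\sqrt{D}}{2\Pi_3},\quad \Gamma_3=\frac{\Pi_3}{\sqrt{D}},\quad \rho_1=\tfrac12\left[\Pi_1+\Pi_4-\sqrt{D}\right],\quad \rho_2=\tfrac12\left[\Pi_1+\Pi_4+\sqrt{D}\right].$$ Then the sequence of iterates $\{x_k\}$ converges and the following bounds hold: $$\mathbb{E}[d(x_{k+1},P)]\le\left(-\Gamma_2\Gamma_3\,\rho_1^k+\Gamma_1\Gamma_3\,\rho_2^k\right)d(x_0,P)\le\rho_2^k\,d(x_0,P),$$ $$\mathbb{E}[\|x_{k+1}-x_k\|]\le\left(-\Gamma_3\,\rho_1^k+\Gamma_3\,\rho_2^k\right)d(x_0,P)\le 2\Gamma_3\,\rho_2^k\,d(x_0,P),$$ where $\Gamma_3\ge 0$ and $0\le|\rho_1|\le\rho_2<1$.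
   Context: Setting: $A\in\mathbb{R}^{m\times n}$ has rows $a_1^T,\dots,a_m^T$ with $\|a_i\|=1$ for all $i$, $b\in\mathbb{R}^m$, and $P=\{x\in\mathbb{R}^n: Ax\le b\}$ is nonempty. $\|\cdot\|$ is the Euclidean norm, $d(x,P)=\inf_{z\in P}\|x-z\|$, $u^+=\max\{u,0\}$ (componentwise for vectors). Fix a sample size $\beta\in\{1,\dots,m\}$. MSKM algorithm (Momentum Sampling Kaczmarz Motzkin): given $x_0\in\mathbb{R}^n$, set $x_1=x_0$; for $k\ge1$, choose a subset $\tau_k\subseteq\{1,\dots,m\}$ of size $\beta$ uniformly at random, let $i^*\in\arg\max_{i\in\tau_k}(a_i^Tx_k-b_i)^+$, and set $$x_{k+1}=x_k-\delta\,(a_{i^*}^Tx_k-b_{i^*})^+a_{i^*}+\gamma(x_k-x_{k-1}).$$ Constants: $L>0$ is a Hoffman constant, i.e. $d(x,P)^2\le L^2\|(Ax-b)^+\|^2$ for all $x\in\mathbb{R}^n$; $\mu_1=\frac{1}{mL^2}$; $\mu_2=\min\{1,\frac{\beta}{m}\lambda_{\max}(A^TA)\}$; $h(\delta)=1-(2\delta-\delta^2)\mu_1$. One has $0<\mu_1\le\mu_2\le1$.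
   Formalization: The bounds containing Γ₁, Γ₂, Γ₃ are stated for D ≠ 0, since D = 0 (e.g. m = L = δ = 1, γ = 0) makes Γ₃ = Π₃/√D undefined; a.s. convergence, E[d(x_{k+1},P)] ≤ ρ₂^k d(x₀,P) and |ρ₁| ≤ ρ₂ < 1 are proved without it. *)

(* Defs.v *)
From HB Require Import structures.
From mathcomp Require Import all_boot all_order all_algebra.
From mathcomp Require Import all_classical all_reals all_analysis.

Set Implicit Arguments.
Unset Strict Implicit.
Unset Printing Implicit Defensive.

Import Order.TTheory GRing.Theory Num.Theory.
Import numFieldNormedType.Exports.

Local Open Scope classical_set_scope.
Local Open Scope ring_scope.

(* The library norm on matrices is the sup norm, hence this definition. *)
Definition l2norm (R : realType) (n : nat) (x : 'cV[R]_n) : R :=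
  Num.sqrt (\sum_(i < n) x i 0 ^+ 2).

Definition dist (R : realType) (n : nat) (x : 'cV[R]_n) (C : set 'cV[R]_n) : R :=
  inf [set l2norm (x - z) | z in C].

Definition polyhedron (R : realType) (m n : nat) (A : 'M[R]_(m, n))
    (b : 'cV[R]_m) : set 'cV[R]_n :=
  [set x | forall i, (A *m x) i 0 <= b i 0].

Definition residual_pos (R : realType) (m n : nat) (A : 'M[R]_(m, n))
    (b : 'cV[R]_m) (x : 'cV[R]_n) : 'cV[R]_m :=
  \col_i Num.max ((A *m x - b) i 0) 0.

Definition hoffman_constant (R : realType) (m n : nat) (A : 'M[R]_(m, n))
    (b : 'cV[R]_m) (L : R) : Prop :=
  0 < L /\
  forall x : 'cV[R]_n,
    dist x (polyhedron A b) ^+ 2 <= L ^+ 2 * l2norm (residual_pos A b x) ^+ 2.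

(* Only used for symmetric M of positive size, whose set of real eigenvalues
   is finite and nonempty, so that the supremum is a maximum. *)
Definition lambda_max (R : realType) (n : nat) (M : 'M[R]_n) : R :=
  sup [set a : R | eigenvalue M a].

Definition mu1 (R : realType) (m : nat) (L : R) : R := (m%:R * L ^+ 2)^-1.

Definition mu2 (R : realType) (m n : nat) (A : 'M[R]_(m, n)) (beta : nat) : R :=
  Num.min 1 (beta%:R / m%:R * lambda_max (A^T *m A)).

Definition hdelta (R : realType) (m : nat) (L delta : R) : R :=
  1 - (2 * delta - delta ^+ 2) * mu1 m L.

(* The event that the samples and selected indices of the steps 1, ..., k-1
   take the prescribed values. *)
Definition history (T : Type) (m : nat) (tau : nat -> T -> {set 'I_m})
    (istar : nat -> T -> 'I_m) (k : nat)
    (S : nat -> {set 'I_m}) (s : nat -> 'I_m) : set T :=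
  [set w | forall l, (1 <= l < k)%N -> tau l w = S l /\ istar l w = s l].

(* At each step k >= 1 the sample tau k is uniform on the beta-subsets of the
   row indices and independent of the past (tau l, istar l), l < k.  The past
   includes the selected indices because ties in the argmax may be broken
   arbitrarily, possibly at random.  Everything being finite-valued, it is
   enough to speak of point events.  Index 0 is not used. *)
Record uniform_sampling (R : realType) (d : measure_display)
    (T : measurableType d) (Pr : probability T R) (m beta : nat)
    (tau : nat -> T -> {set 'I_m}) (istar : nat -> T -> 'I_m) : Prop := {
  measurable_sample : forall k (S : {set 'I_m}), (1 <= k)%N ->
    measurable [set w | tau k w = S];
  measurable_index : forall k (i : 'I_m), (1 <= k)%N ->
    measurable [set w | istar k w = i];
  card_sample : forall k w, (1 <= k)%N -> #|tau k w| = beta;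
  uniform_sample : forall k (S : {set 'I_m}), (1 <= k)%N -> #|S| = beta ->
    Pr [set w | tau k w = S] = (('C(m, beta))%:R^-1)%:E;
  independent_sample : forall k (S0 : {set 'I_m}) S s, (1 <= k)%N ->
    Pr ([set w | tau k w = S0] `&` history tau istar k S s) =
    (Pr [set w | tau k w = S0] * Pr (history tau istar k S s))%E }.

Record mskm (R : realType) (T : Type) (m n : nat) (A : 'M[R]_(m, n))
    (b : 'cV[R]_m) (delta gamma : R) (x0 : 'cV[R]_n)
    (tau : nat -> T -> {set 'I_m}) (istar : nat -> T -> 'I_m)
    (x : nat -> T -> 'cV[R]_n) : Prop := {
  mskm_start0 : forall w, x 0%N w = x0;
  mskm_start1 : forall w, x 1%N w = x0;
  mskm_index : forall k w, (1 <= k)%N -> istar k w \in tau k w;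
  mskm_argmax : forall k w (i : 'I_m), (1 <= k)%N -> i \in tau k w ->
    residual_pos A b (x k w) i 0 <= residual_pos A b (x k w) (istar k w) 0;
  mskm_step : forall k w, (1 <= k)%N ->
    x k.+1 w = x k w
      - (delta * residual_pos A b (x k w) (istar k w) 0) *: (row (istar k w) A)^T
      + gamma *: (x k w - x k.-1 w) }.

(* Main.v *)
(** Conditionally on the past, one step satisfies, for every [p] in [P] and with
    [r] the largest residual over the sample,
    [|x - p - delta r a|^2 <= |x - p|^2 - (2 delta - delta^2) r^2], and
    [|x_{k+1} - x_k| <= delta r + gamma |x_k - x_{k-1}|].  Double counting gives
    [|(Ax-b)^+|^2 / m <= E r^2 <= (beta / m) |(Ax-b)^+|^2]; Hoffman's bound on the
    left, the Rayleigh quotient on the right, and Jensen's inequality show that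
    [u_k = E d(x_{k+1}, P)] and [v_k = E |x_{k+1} - x_k|] are dominated by the
    powers of the matrix with rows [(Pi1, Pi2)] and [(Pi3, Pi4)] applied to
    [(d(x_0, P), 0)], whose eigenvalues are [rho1] and [rho2].  Since
    [(1 - Pi1)(1 - gamma) > gamma Pi3], the series of the [v_k] converges, so
    almost surely the increments are summable and the iterates converge. *)

Require Import Defs.
From HB Require Import structures.
From mathcomp Require Import all_boot all_order all_algebra.
From mathcomp Require Import all_classical all_reals all_analysis.
From mathcomp Require Import measurable_realfun.
From mathcomp Require Import ring lra.

Set Implicit Arguments.
Unset Strict Implicit.
Unset Printing Implicit Defensive.

Import Order.TTheory GRing.Theory Num.Theory.
Import numFieldNormedType.Exports.

Local Open Scope classical_set_scope.
Local Open Scope ring_scope.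

(** * The Euclidean inner product and norm on column vectors *)

Section Euclid.
Context {R : realType}.

Definition dotp (n : nat) (u v : 'cV[R]_n) : R := (u^T *m v) 0 0.

Lemma dotpE n (u v : 'cV[R]_n) : dotp u v = \sum_i u i 0 * v i 0.
Proof. by rewrite /dotp mxE; apply: eq_bigr => i _; rewrite mxE. Qed.

Lemma dotpC n (u v : 'cV[R]_n) : dotp u v = dotp v u.
Proof. by rewrite !dotpE; apply: eq_bigr => i _; rewrite mulrC. Qed.

Lemma dotpDr n (u v w : 'cV[R]_n) : dotp u (v + w) = dotp u v + dotp u w.
Proof. by rewrite /dotp mulmxDr mxE. Qed.

Lemma dotpDl n (u v w : 'cV[R]_n) : dotp (v + w) u = dotp v u + dotp w u.
Proof. by rewrite dotpC dotpDr !(dotpC u). Qed.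

Lemma dotpZr n a (u v : 'cV[R]_n) : dotp u (a *: v) = a * dotp u v.
Proof. by rewrite /dotp -scalemxAr mxE. Qed.

Lemma dotpZl n a (u v : 'cV[R]_n) : dotp (a *: u) v = a * dotp u v.
Proof. by rewrite dotpC dotpZr dotpC. Qed.

Lemma dotpNr n (u v : 'cV[R]_n) : dotp u (- v) = - dotp u v.
Proof. by rewrite -scaleN1r dotpZr mulN1r. Qed.

Lemma dotpNl n (u v : 'cV[R]_n) : dotp (- u) v = - dotp u v.
Proof. by rewrite dotpC dotpNr dotpC. Qed.

Lemma dotp_ge0 n (u : 'cV[R]_n) : 0 <= dotp u u.
Proof. by rewrite dotpE sumr_ge0 // => i _; rewrite -expr2 sqr_ge0. Qed.

Lemma dotp_eq0 n (u : 'cV[R]_n) : dotp u u = 0 -> u = 0.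
Proof.
move=> /eqP; rewrite dotpE psumr_eq0 => [/allP u0|i _]; last first.
  by rewrite -expr2 sqr_ge0.
apply/colP => i; rewrite mxE; apply/eqP.
by have := u0 i (mem_index_enum _); rewrite /= mulf_eq0 orbb.
Qed.

Lemma l2norm_ge0 n (u : 'cV[R]_n) : 0 <= l2norm u.
Proof. exact: sqrtr_ge0. Qed.

Lemma sqr_l2norm n (u : 'cV[R]_n) : l2norm u ^+ 2 = dotp u u.
Proof.
by rewrite /l2norm sqr_sqrtr ?dotpE ?sumr_ge0 // => i _; rewrite sqr_ge0.
Qed.

(** Cauchy-Schwarz: expand the square of [|v| u - |u| v], which is nonnegative, and cancel the
    factor [|u| |v|]; the zero vectors are split off so that this factor is positive. *)
Lemma dotp_le_l2norm n (u v : 'cV[R]_n) : dotp u v <= l2norm u * l2norm v.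
Proof.
have [/eqP u0|u_neq0] := boolP (l2norm u == 0).
  have /dotp_eq0 -> : dotp u u = 0 by rewrite -sqr_l2norm u0 expr0n.
  by rewrite dotpE big1 ?mulr_ge0 ?l2norm_ge0 // => i _; rewrite mxE mul0r.
have [/eqP v0|v_neq0] := boolP (l2norm v == 0).
  have /dotp_eq0 -> : dotp v v = 0 by rewrite -sqr_l2norm v0 expr0n.
  by rewrite dotpE big1 ?mulr_ge0 ?l2norm_ge0 // => i _; rewrite mxE mulr0.
have uv_gt0 : 0 < l2norm u * l2norm v.
  by rewrite mulr_gt0 // lt_neqAle eq_sym ?u_neq0 ?v_neq0 l2norm_ge0.
have := dotp_ge0 (l2norm v *: u - l2norm u *: v).
rewrite !(dotpDl, dotpDr, dotpNl, dotpNr, dotpZl, dotpZr) -!sqr_l2norm.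
rewrite (dotpC v u) => h.
rewrite -(ler_pM2l uv_gt0); nra.
Qed.

Lemma l2normD n (u v : 'cV[R]_n) : l2norm (u + v) <= l2norm u + l2norm v.
Proof.
rewrite -(ler_pXn2r (n := 2)) ?nnegrE ?addr_ge0 ?l2norm_ge0 //.
rewrite sqr_l2norm sqrrD !sqr_l2norm !(dotpDl, dotpDr) (dotpC v u).
have := dotp_le_l2norm u v; lra.
Qed.

Lemma sqr_l2normB n (u v : 'cV[R]_n) :
  l2norm (u - v) ^+ 2 = l2norm u ^+ 2 - 2 * dotp u v + l2norm v ^+ 2.
Proof.
by rewrite !sqr_l2norm !(dotpDl, dotpDr, dotpNl, dotpNr) (dotpC v u); ring.
Qed.

Lemma l2normZ n a (u : 'cV[R]_n) : l2norm (a *: u) = `|a| * l2norm u.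
Proof.
apply/eqP; rewrite -(eqrXn2 (n := 2)) ?mulr_ge0 ?l2norm_ge0 //.
by rewrite exprMn !sqr_l2norm dotpZl dotpZr real_normK ?num_real // mulrA.
Qed.

Lemma l2norm0 n : l2norm (0 : 'cV[R]_n) = 0.
Proof. by rewrite -(scale0r (0 : 'cV[R]_n)) l2normZ normr0 mul0r. Qed.

Lemma ler_l2norm_coord n (u : 'cV[R]_n) i : `|u i 0| <= l2norm u.
Proof.
rewrite -(ler_pXn2r (n := 2)) ?nnegrE ?l2norm_ge0 //.
rewrite real_normK ?num_real // sqr_l2norm dotpE (bigD1 i) //= -expr2 lerDl.
by rewrite sumr_ge0 // => j _; rewrite -expr2 sqr_ge0.
Qed.

Lemma dotp_row m n (A : 'M[R]_(m, n)) i (u : 'cV[R]_n) :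
  (A *m u) i 0 = dotp (row i A)^T u.
Proof. by rewrite /dotp trmxK -row_mul [RHS]mxE. Qed.

End Euclid.

(** * Rayleigh quotients and the largest eigenvalue of a symmetric matrix *)

Section Rayleigh.
Context {R : realType}.

Lemma continuous_qform n (M : 'M[R]_n) :
  continuous (fun v : 'rV[R]_n => (v *m M *m v^T) 0 0).
Proof.
have -> : (fun v : 'rV[R]_n => (v *m M *m v^T) 0 0) =
          (fun v => \sum_i (\sum_j v 0 j * M j i) * v 0 i).
  by apply/funext => v; rewrite mxE; apply: eq_bigr => i _; rewrite !mxE.
apply: (continuous_big add_continuous) => i _ v.
apply: continuousM; last exact: coord_continuous.
apply: (continuous_big add_continuous) => j _ {}v.
by apply: continuousM; [exact: coord_continuous|exact: cst_continuous].
Qed.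

Lemma compact_sphere n : compact [set v : 'rV[R]_n | (v *m v^T) 0 0 = 1].
Proof.
apply: bounded_closed_compact.
  exists 1; split => // r r1 v /= v1; apply: le_trans (ltW r1).
  rewrite [leLHS]/Num.Def.normr/= mx_normrE; apply: bigmax_le => //.
  move=> -[i j] _ /=; rewrite (ord1 i).
  rewrite -(@ler_pXn2r _ 2) ?nnegrE //.
  rewrite real_normK ?num_real // expr1n -v1 mxE (bigD1 j) //= mxE -expr2.
  by rewrite lerDl sumr_ge0 // => k _; rewrite mxE -expr2 sqr_ge0.
rewrite (_ : mkset _ = (fun v : 'rV[R]_n => (v *m 1%:M *m v^T) 0 0) @^-1` [set 1]).
  by apply: closed_comp => [v _|]; [exact: continuous_qform|exact: closed_eq].
by apply/seteqP; split => v /=; rewrite mulmx1.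
Qed.

Lemma qformD n (N : 'M[R]_n) (u v : 'rV[R]_n) t :
  ((u + t *: v) *m N *m (u + t *: v)^T) 0 0 =
  (u *m N *m u^T) 0 0 + t * ((u *m N *m v^T) 0 0 + (v *m N *m u^T) 0 0)
    + t ^+ 2 * (v *m N *m v^T) 0 0.
Proof.
have addE (X Y : 'M[R]_1) : (X + Y) 0 0 = X 0 0 + Y 0 0 by rewrite mxE.
have scaleE k (X : 'M[R]_1) : (k *: X) 0 0 = k * X 0 0 by rewrite mxE.
have -> : (u + t *: v)^T = u^T + t *: v^T by rewrite linearD linearZ.
rewrite !mulmxDl !mulmxDr -!scalemxAl -!scalemxAr.
by rewrite !(addE, scaleE); ring.
Qed.

(* A maximiser of the quadratic form on the unit sphere is an eigenvector. *)
Lemma rayleigh n (M : 'M[R]_n) : (0 < n)%N -> M^T = M ->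
  exists2 a, eigenvalue M a &
    forall v : 'rV[R]_n, (v *m M *m v^T) 0 0 <= a * (v *m v^T) 0 0.
Proof.
move=> n_gt0 symM.
have sq_ge0 (v : 'rV[R]_n) : 0 <= (v *m v^T) 0 0.
  by rewrite mxE sumr_ge0 // => i _; rewrite mxE -expr2 sqr_ge0.
have sq_eq0 (v : 'rV[R]_n) : (v *m v^T) 0 0 = 0 -> v = 0.
  move=> v0; apply: trmx_inj; rewrite trmx0.
  by apply: dotp_eq0; rewrite /dotp trmxK.
have S0 : [set v : 'rV[R]_n | (v *m v^T) 0 0 = 1] !=set0.
  exists (delta_mx 0 (Ordinal n_gt0)).
  by rewrite /= trmx_delta mul_delta_mx mxE !eqxx.
have cf : {within [set v : 'rV[R]_n | (v *m v^T) 0 0 = 1],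
    continuous (fun v : 'rV[R]_n => (v *m M *m v^T) 0 0)}.
  by apply: continuous_subspaceT; exact: continuous_qform.
have [c] := EVT_max_rV S0 (@compact_sphere n) cf.
rewrite inE /= => c1 cmax.
set a := (c *m M *m c^T) 0 0 in cmax.
have le_a (v : 'rV[R]_n) : (v *m M *m v^T) 0 0 <= a * (v *m v^T) 0 0.
  have [v0|vn0] := eqVneq ((v *m v^T) 0 0) 0.
    by rewrite (sq_eq0 _ v0) !mul0mx !mxE mulr0.
  have v_gt0 : 0 < (v *m v^T) 0 0 by rewrite lt_neqAle eq_sym vn0 sq_ge0.
  set q := (v *m v^T) 0 0 in vn0 v_gt0 *.
  (* Normalising [v] by [t] puts it on the unit sphere, where [c] is maximal. *)
  pose t := (Num.sqrt q)^-1.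
  have tt : t * t = q^-1 by rewrite /t -invfM -expr2 sqr_sqrtr // ltW.
  have scaled (N : 'M[R]_n) :
      ((t *: v) *m N *m (t *: v)^T) 0 0 = q^-1 * (v *m N *m v^T) 0 0.
    by rewrite linearZ /= -!scalemxAl -!scalemxAr scalerA tt [LHS]mxE.
  have := cmax (t *: v); rewrite inE /= scaled.
  have := scaled 1%:M; rewrite !mulmx1 -/q => -> cm.
  by rewrite mulrC -ler_pdivrMl //; apply: cm; rewrite mulVf.
exists a => //; apply/eigenvalueP; exists c; last first.
  by apply/eqP => c0; move: c1; rewrite c0 mul0mx mxE => /eqP; rewrite eq_sym oner_eq0.
(* [N] is positive semidefinite and its form vanishes at [c], so [c] minimises it; first-order
   optimality will give [c *m N = 0]. *)
pose N := a%:M - M.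
have symN : N^T = N by rewrite /N linearB /= tr_scalar_mx symM.
have Nge0 (v : 'rV[R]_n) : 0 <= (v *m N *m v^T) 0 0.
  rewrite /N mulmxBr mulmxBl mul_mx_scalar -scalemxAl.
  by rewrite [leRHS]mxE [X in _ <= X + _]mxE [X in _ <= _ + X]mxE subr_ge0.
have Nc : (c *m N *m c^T) 0 0 = 0.
  rewrite /N mulmxBr mulmxBl mul_mx_scalar -scalemxAl.
  by rewrite [LHS]mxE [X in X + _ = _]mxE [X in _ + X = _]mxE c1 mulr1 subrr.
suff cN0 : c *m N = 0.
  by apply/eqP; rewrite eq_sym -subr_eq0 -mul_mx_scalar -mulmxBr; apply/eqP.
apply: sq_eq0; set v := c *m N; set p := (v *m v^T) 0 0.
set q := (v *m N *m v^T) 0 0; have q_ge0 : 0 <= q := Nge0 v.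
have vNc : (v *m N *m c^T) 0 0 = p.
  by rewrite -[N in LHS]symN -mulmxA -trmx_mul.
(* Perturb [c] along [v = c N]. The form at [c + t v] is [2 t p + t^2 q], and [t = -p/(q+1)] makes
   it negative unless [p = 0]; the [+ 1] keeps the denominator positive when [q = 0]. *)
have := Nge0 (c + (- p / (q + 1)) *: v); rewrite qformD Nc vNc -/v -/p -/q.
have q1 : 0 < q + 1 by lra.
have -> : 0 + (- p / (q + 1)) * (p + p) + (- p / (q + 1)) ^+ 2 * q =
   - (p ^+ 2 * (q + 2)) / (q + 1) ^+ 2 by field; rewrite gt_eqF.
rewrite ler_pdivlMr ?exprn_gt0 // mul0r oppr_ge0 pmulr_lle0; last by lra.
by move=> h; apply/eqP; rewrite -sqrf_eq0 eq_le h sqr_ge0.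
Qed.

(** The eigenvalue [a] supplied by [rayleigh] dominates every eigenvalue [e], as testing its bound
    on an eigenvector of [e] shows; hence the supremum is attained and equals [a]. *)
Lemma lambda_maxP n (M : 'M[R]_n) : (0 < n)%N -> M^T = M ->
  forall v : 'cV[R]_n, dotp v (M *m v) <= lambda_max M * dotp v v.
Proof.
move=> n_gt0 symM v; have [a ea le_a] := rayleigh n_gt0 symM.
suff -> : lambda_max M = a by have := le_a v^T; rewrite trmxK -mulmxA.
have eigen_le e : eigenvalue M e -> e <= a.
  move=> /eigenvalueP[u ue u0]; have := le_a u.
  rewrite ue -scalemxAl [leLHS]mxE ler_pM2r // lt_neqAle eq_sym.
  have := dotp_ge0 u^T; rewrite {1}/dotp trmxK => ->; rewrite andbT.
  apply: contraNneq u0 => u0; apply/eqP/trmx_inj; rewrite trmx0.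
  by apply: dotp_eq0; rewrite /dotp trmxK.
apply/eqP; rewrite eq_le; apply/andP; split.
  by apply: ge_sup; [exists a|move=> e; exact: eigen_le].
by apply: ub_le_sup => //; exists a => e; exact: eigen_le.
Qed.

End Rayleigh.

(** * Distance to a nonempty set *)

Section Distance.
Context {R : realType} {n : nat} (C : set 'cV[R]_n) (C0 : C !=set0).
Implicit Types x y z : 'cV[R]_n.

Lemma dist_le x z : C z -> dist x C <= l2norm (x - z).
Proof.
move=> Cz; apply: ge_inf; last by exists z.
by exists 0 => _ [y _ <-]; exact: l2norm_ge0.
Qed.

Lemma le_dist x (c : R) : (forall z, C z -> c <= l2norm (x - z)) -> c <= dist x C.
Proof.
move=> h; apply: lb_le_inf; first by case: C0 => z Cz; exists (l2norm (x - z)), z.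
by move=> _ [z Cz <-]; exact: h.
Qed.

Lemma dist_ge0 x : 0 <= dist x C.
Proof. by apply: le_dist => z _; exact: l2norm_ge0. Qed.

Lemma distD x y : dist (x + y) C <= dist x C + l2norm y.
Proof.
rewrite -lerBlDr; apply: le_dist => z Cz; rewrite lerBlDr.
by rewrite (le_trans (dist_le _ Cz)) // addrAC l2normD.
Qed.

End Distance.

(** * Deterministic estimates for one projection step *)

Section Step.
Context {R : realType} {m n : nat} (A : 'M[R]_(m, n)) (b : 'cV[R]_m).
Hypothesis unit_row : forall i, l2norm (row i A)^T = 1.
Let P := polyhedron A b.
Hypothesis P0 : P !=set0.
Implicit Types (x p : 'cV[R]_n) (i : 'I_m).

Lemma residual_ge0 x i : 0 <= residual_pos A b x i 0.
Proof. by rewrite mxE le_max lexx orbT. Qed.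

Lemma residual_le_norm x p i : P p ->
  residual_pos A b x i 0 <= `|(A *m (x - p)) i 0|.
Proof.
move=> /(_ i) Pp; rewrite [leLHS]mxE ge_max normr_ge0 andbT.
rewrite (le_trans _ (ler_norm _)) // mulmxBr !mxE /= lerD2l lerN2.
by move: Pp; rewrite mxE.
Qed.

Lemma residual_le_dist x i : residual_pos A b x i 0 <= dist x P.
Proof.
apply: le_dist => // p /(residual_le_norm x i) /le_trans; apply.
rewrite dotp_row ler_norml -lerNl -dotpNr.
rewrite !(le_trans (dotp_le_l2norm _ _)) ?unit_row ?mul1r //.
by rewrite -scaleN1r l2normZ normrN1 mul1r.
Qed.

(** The extra factor [r] absorbs the positive part: both sides vanish when [r = 0], and otherwise
    [r = (Ax - b)_i], which is at most [(A(x - p))_i] since [p] is feasible. *)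
Lemma residual_sqr_le x p i : P p ->
  residual_pos A b x i 0 ^+ 2 <= residual_pos A b x i 0 * dotp (row i A)^T (x - p).
Proof.
move=> /(_ i) Pp; rewrite expr2 -dotp_row.
have r_ge0 := residual_ge0 x i.
have [->|rn0] := eqVneq (residual_pos A b x i 0) 0; first by rewrite !mul0r.
rewrite ler_wpM2l //; move: rn0.
have -> : residual_pos A b x i 0 = Num.max ((A *m x - b) i 0) 0 by rewrite mxE.
have [_|_ _] := leP ((A *m x - b) i 0) 0; first by rewrite eqxx.
rewrite mulmxBr mxE [leRHS]mxE [X in _ + X <= _]mxE [X in _ <= _ + X]mxE.
by rewrite lerD2l lerN2.
Qed.

Lemma dist_step (delta : R) x i : 0 < delta < 2 ->
  dist (x - (delta * residual_pos A b x i 0) *: (row i A)^T) P ^+ 2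
    + (2 * delta - delta ^+ 2) * residual_pos A b x i 0 ^+ 2 <= dist x P ^+ 2.
Proof.
move=> /andP[d0 d2]; set r := residual_pos A b x i 0; set y := _ - _.
have y_ge0 := @dist_ge0 _ _ _ P0 y.
set c := _ - delta ^+ 2.
have c_ge0 : 0 <= c by rewrite /c; nra.
have cr_ge0 : 0 <= c * r ^+ 2 by rewrite mulr_ge0 ?sqr_ge0.
have s_ge0 : 0 <= dist y P ^+ 2 + c * r ^+ 2 by rewrite addr_ge0 ?sqr_ge0.
(* As [dist] is an infimum, the root of the left side is shown to be a lower bound of
   [l2norm (x - p)] for every [p] in [P]. *)
suff : Num.sqrt (dist y P ^+ 2 + c * r ^+ 2) <= dist x P.
  by move=> h; rewrite -[leLHS]sqr_sqrtr // ler_pXn2r ?nnegrE ?sqrtr_ge0 ?dist_ge0.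
apply: le_dist => // p Pp.
rewrite -(ler_pXn2r (n := 2)) ?nnegrE ?sqrtr_ge0 ?l2norm_ge0 // sqr_sqrtr //.
have yp : dist y P ^+ 2 <= l2norm (y - p) ^+ 2.
  by rewrite ler_pXn2r ?nnegrE ?l2norm_ge0 //; exact: dist_le.
apply: le_trans (lerD yp (lexx _)) _.
have := residual_sqr_le x i Pp; rewrite -/r (dotpC _ (x - p)) => rr.
set u := x - p in rr *.
have -> : y - p = u - (delta * r) *: (row i A)^T by rewrite /y /u addrAC.
by rewrite sqr_l2normB l2normZ unit_row dotpZr mulr1 real_normK ?num_real // /c; nra.
Qed.

(** Each residual is dominated by the matching entry of [A(x - p)], whose squared norm is the
    quadratic form of [A^T A] at [x - p]. *)
Lemma residual_norm_le_lambda x p : (0 < n)%N -> P p ->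
  l2norm (residual_pos A b x) ^+ 2 <= lambda_max (A^T *m A) * l2norm (x - p) ^+ 2.
Proof.
move=> n_gt0 Pp; rewrite !sqr_l2norm.
have -> : dotp (residual_pos A b x) (residual_pos A b x) =
    \sum_i residual_pos A b x i 0 ^+ 2 by rewrite dotpE.
apply: (@le_trans _ _ (dotp (x - p) ((A^T *m A) *m (x - p)))); last first.
  by apply: lambda_maxP; rewrite // trmx_mul trmxK.
have -> : dotp (x - p) (A^T *m A *m (x - p)) = dotp (A *m (x - p)) (A *m (x - p)).
  by rewrite /dotp trmx_mul !mulmxA.
rewrite dotpE; apply: ler_sum => i _; rewrite -expr2.
rewrite -[leRHS]real_normK ?num_real // ler_pXn2r ?nnegrE ?residual_ge0 //.
exact: residual_le_norm.
Qed.

(** Test the Rayleigh bound on a row [a] of [A]: the entry of [A a] at that row is [|a|^2 = 1]. This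
    provides the positivity used to divide by the root of [lambda_max]. *)
Lemma lambda_max_ge1 : (0 < m)%N -> (0 < n)%N -> 1 <= lambda_max (A^T *m A).
Proof.
move=> m_gt0 n_gt0; pose i := Ordinal m_gt0; pose a := (row i A)^T.
have a1 : dotp a a = 1 by rewrite -sqr_l2norm unit_row expr1n.
have := @lambda_maxP R n (A^T *m A) n_gt0 _ a; rewrite trmx_mul trmxK a1 mulr1.
move=> /(_ erefl); apply: le_trans.
have -> : dotp a (A^T *m A *m a) = dotp (A *m a) (A *m a).
  by rewrite /dotp trmx_mul !mulmxA.
rewrite dotpE (bigD1 i) //= dotp_row a1 mulr1 lerDl sumr_ge0 // => j _.
by rewrite -expr2 sqr_ge0.
Qed.

Lemma residual_norm_le_dist x : (0 < m)%N -> (0 < n)%N ->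
  l2norm (residual_pos A b x) ^+ 2 <= lambda_max (A^T *m A) * dist x P ^+ 2.
Proof.
move=> m_gt0 n_gt0; have l1 := lambda_max_ge1 m_gt0 n_gt0.
set l := lambda_max _ in l1 *; have l0 : 0 < l by lra.
have sl0 : 0 < Num.sqrt l by rewrite sqrtr_gt0.
rewrite -[l]sqr_sqrtr ?(ltW l0) // -exprMn ler_pXn2r ?nnegrE ?l2norm_ge0 //.
  rewrite -ler_pdivrMl //; apply: le_dist => // p Pp.
  rewrite ler_pdivrMl // -(ler_pXn2r (n := 2)) ?nnegrE ?mulr_ge0 ?l2norm_ge0 ?(ltW sl0) //.
  by rewrite exprMn (sqr_sqrtr (ltW l0)); exact: residual_norm_le_lambda.
by rewrite mulr_ge0 ?dist_ge0 // ltW.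
Qed.

End Step.

(** * Averages over the uniform subset of size [beta] *)

Section SampleMean.
Context {R : realType} {m : nat} (beta : nat).
Hypothesis beta_m : (1 <= beta <= m)%N.
Implicit Types (f g : {set 'I_m} -> R) (c : 'I_m -> R) (S : {set 'I_m}).

Definition sample_mean f : R :=
  ('C(m, beta))%:R^-1 * \sum_(S : {set 'I_m} | #|S| == beta) f S.

Lemma bin_gt0R : 0 < ('C(m, beta))%:R :> R.
Proof. by rewrite ltr0n bin_gt0; case/andP: beta_m. Qed.

Lemma le_sample_mean f g : (forall S, #|S| = beta -> f S <= g S) ->
  sample_mean f <= sample_mean g.
Proof.
move=> fg; rewrite ler_wpM2l ?invr_ge0 ?ler0n //.
by apply: ler_sum => S /eqP; exact: fg.
Qed.

Lemma sample_meanD f g :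
  sample_mean (fun S => f S + g S) = sample_mean f + sample_mean g.
Proof. by rewrite /sample_mean big_split mulrDr. Qed.

Lemma sample_meanZ a f : sample_mean (fun S => a * f S) = a * sample_mean f.
Proof. by rewrite /sample_mean -mulr_sumr mulrCA. Qed.

Lemma sample_mean_cst a : sample_mean (fun=> a) = a.
Proof.
rewrite /sample_mean sumr_const (_ : #|_| = 'C(m, beta)).
  by rewrite -[a *+ _]mulr_natl mulKf // gt_eqF // bin_gt0R.
rewrite -[m in RHS](card_ord m) -card_draws.
by apply: eq_card => S; rewrite !inE.
Qed.

Lemma sample_mean_ge0 f : (forall S, #|S| = beta -> 0 <= f S) -> 0 <= sample_mean f.
Proof. by move=> f0; rewrite -(sample_mean_cst 0); exact: le_sample_mean. Qed.

(** Jensen for the square: the difference of the two sides is the mean of [(f - a)^2], with [a] the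
    mean of [f]. *)
Lemma sqr_sample_mean_le f : sample_mean f ^+ 2 <= sample_mean (fun S => f S ^+ 2).
Proof.
set a := sample_mean f; rewrite -subr_ge0.
have -> : sample_mean (fun S => f S ^+ 2) - a ^+ 2 =
    sample_mean (fun S => f S ^+ 2 + (- (2 * a) * f S + a ^+ 2)).
  by rewrite !sample_meanD sample_meanZ sample_mean_cst -/a; ring.
by apply: sample_mean_ge0 => S _; have := sqr_ge0 (f S - a); lra.
Qed.

(** Double counting: each index lies in [C(m-1, beta-1)] samples, and
    [m C(m-1, beta-1) = beta C(m, beta)]. *)
Lemma sample_mean_sum c :
  sample_mean (fun S => \sum_(i in S) c i) = beta%:R / m%:R * \sum_i c i.
Proof.
case/andP: beta_m => beta_gt0 beta_le.
have m_gt0 : (0 < m)%N := leq_trans beta_gt0 beta_le.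
pose samples := [set S : {set 'I_m} | #|S| == beta]%SET.
pose containing i := [set S : {set 'I_m} | i \in S]%SET.
(* Samples avoiding [i] are the [beta]-subsets of the other [m - 1] indices; Pascal's rule then
   counts those containing [i]. *)
have count i : #|samples :&: containing i| = 'C(m.-1, beta.-1).
  have card_samples : #|samples| = 'C(m, beta) by rewrite card_draws card_ord.
  have card_avoiding : #|samples :\: containing i| = 'C(m.-1, beta).
    rewrite -[m in RHS](card_ord m) -cardsT (cardsD1 i) inE -cards_draws.
    by apply: eq_card => S; rewrite !inE subsetD1 finset.subsetT.
  have : 'C(m, beta) = ('C(m.-1, beta) + 'C(m.-1, beta.-1))%N.
    by case: m m_gt0 beta beta_gt0 => // ? _ [|?].
  by rewrite -card_samples -card_avoiding -(cardsID (containing i)) addnC => /addnI.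
rewrite /sample_mean (exchange_big_dep xpredT) //= mulr_sumr [RHS]mulr_sumr.
apply: eq_bigr => i _.
rewrite sumr_const (_ : #|_| = 'C(m.-1, beta.-1)) -?(count i); last first.
  by apply: eq_card => S; rewrite !inE.
rewrite count -[c i *+ _]mulr_natl mulrA; congr (_ * _).
have := @mul_bin_diag m beta.-1; rewrite prednK // => /(congr1 (fun k => k%:R : R)).
rewrite !natrM => E.
have C0 : ('C(m, beta))%:R != 0 :> R by rewrite gt_eqF // bin_gt0R.
have m0 : m%:R != 0 :> R by rewrite pnatr_eq0 -lt0n.
by apply: (mulfI m0); apply: (mulfI C0); rewrite mulrCA mulVKf // E; field.
Qed.

End SampleMean.

(** * Mean decrease of the distance and mean step length over one sample *)

Section SampleBounds.
Context {R : realType} {m n : nat} (A : 'M[R]_(m, n)) (b : 'cV[R]_m).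
Hypothesis unit_row : forall i, l2norm (row i A)^T = 1.
Let P := polyhedron A b.
Hypothesis P0 : P !=set0.
Variable beta : nat.
Hypothesis beta_m : (1 <= beta <= m)%N.
Variable L : R.
Hypothesis hL : hoffman_constant A b L.
Implicit Types (x p : 'cV[R]_n) (i : 'I_m) (S : {set 'I_m}).

(** Depends on the sample but not on how ties in the argmax are broken. The default 0 is neutral
    because residuals are nonnegative. *)
Definition max_residual x S : R :=
  \big[Num.max/0]_(i in S) residual_pos A b x i 0.

Lemma max_residual_ge0 x S : 0 <= max_residual x S.
Proof. exact: bigmax_ge_id. Qed.

Lemma le_max_residual x S i : i \in S -> residual_pos A b x i 0 <= max_residual x S.
Proof. by move=> iS; apply: (bigmax_sup i). Qed.

Lemma max_residual_argmax x S i : i \in S ->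
  (forall j, j \in S -> residual_pos A b x j 0 <= residual_pos A b x i 0) ->
  max_residual x S = residual_pos A b x i 0.
Proof.
move=> iS imax; apply/eqP; rewrite eq_le le_max_residual // andbT.
by apply: bigmax_le => // ; exact: residual_ge0.
Qed.

Lemma max_residual_le_dist x S : max_residual x S <= dist x P.
Proof.
by apply: bigmax_le => [|i _]; [exact: dist_ge0|exact: residual_le_dist].
Qed.

Lemma max_residual_sqr_le x S :
  max_residual x S ^+ 2 <= \sum_(i in S) residual_pos A b x i 0 ^+ 2.
Proof.
rewrite /max_residual; elim/big_rec2 : _ => [|i s r _ rs]; first by rewrite expr0n.
have [_|_] := leP (residual_pos A b x i 0) r; last first.
  by rewrite lerDl (le_trans (sqr_ge0 _) rs).
by rewrite (le_trans rs) // lerDr sqr_ge0.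
Qed.

Lemma max_residual_sqr_ge x S : #|S| = beta ->
  \sum_(i in S) residual_pos A b x i 0 ^+ 2 <= beta%:R * max_residual x S ^+ 2.
Proof.
move=> <-; rewrite mulr_natl -sumr_const; apply: ler_sum => i iS.
by rewrite ler_pXn2r ?nnegrE ?max_residual_ge0 ?residual_ge0 ?le_max_residual.
Qed.

Let m_gt0 : (0 < m)%N.
Proof. by case/andP: beta_m; exact: leq_trans. Qed.

Let n_gt0 : (0 < n)%N.
Proof.
have := unit_row (Ordinal m_gt0).
rewrite lt0n; apply: contra_eqN => /eqP n0; rewrite /l2norm big1 ?sqrtr0.
  by rewrite eq_sym oner_eq0.
by move=> i; exfalso; have := ltn_ord i; rewrite [X in (_ < X)%N]n0.
Qed.

Let sum_residual x :
  \sum_i residual_pos A b x i 0 ^+ 2 = l2norm (residual_pos A b x) ^+ 2.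
Proof. by rewrite sqr_l2norm dotpE. Qed.

Lemma mu2_gt0 : 0 < mu2 A beta.
Proof.
rewrite /mu2 lt_min ltr01 mulr_gt0 ?divr_gt0 ?ltr0n //.
  by case/andP: beta_m.
by have := lambda_max_ge1 unit_row m_gt0 n_gt0; lra.
Qed.

(** After Jensen, the two arguments of the minimum in [mu2] come from two bounds on the squared
    maximum: by the squared distance, since rows are unit vectors, or by the sum over the sample,
    followed by double counting and the Rayleigh bound. *)
Lemma sample_mean_residual_le x :
  sample_mean beta (max_residual x) <= Num.sqrt (mu2 A beta) * dist x P.
Proof.
have d_ge0 : 0 <= dist x P := dist_ge0 P0 x.
have s_ge0 : 0 <= sample_mean beta (max_residual x).
  by apply: sample_mean_ge0 => // S _; exact: max_residual_ge0.
rewrite -(ler_pXn2r (n := 2)) ?nnegrE ?(mulr_ge0 (sqrtr_ge0 _)) //.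
rewrite [leRHS]exprMn (sqr_sqrtr (ltW mu2_gt0)).
apply: le_trans (sqr_sample_mean_le beta_m _) _.
rewrite /mu2; case: (leP 1 _) => _.
  rewrite mul1r -[leRHS](sample_mean_cst beta_m); apply: le_sample_mean => S _.
  by rewrite ler_pXn2r ?nnegrE ?max_residual_ge0 ?max_residual_le_dist.
rewrite -[leRHS]mulrA.
have := residual_norm_le_dist (b := b) unit_row P0 x m_gt0 n_gt0.
have bm_ge0 : 0 <= beta%:R / m%:R :> R by rewrite divr_ge0.
move=> /(ler_wpM2l bm_ge0); apply: le_trans.
rewrite -sum_residual -sample_mean_sum //; apply: le_sample_mean => S _.
exact: max_residual_sqr_le.
Qed.

(** Jensen moves the mean under the root. There the mean squared maximum is at least [1/m] times the
    squared residual norm, since [beta] times a squared maximum exceeds the sum over the sample, and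
    Hoffman's bound turns this into [mu1] times the squared distance. *)
Lemma sample_mean_dist_le x (delta : R) : 0 < delta < 2 ->
  sample_mean beta
    (fun S => Num.sqrt (dist x P ^+ 2 - (2 * delta - delta ^+ 2) * max_residual x S ^+ 2))
  <= Num.sqrt (hdelta m L delta) * dist x P.
Proof.
move=> /andP[d0 d2]; set c := 2 * delta - _.
have d_ge0 : 0 <= dist x P := dist_ge0 P0 x.
have c_gt0 : 0 < c by rewrite /c; nra.
(* [c = 1 - (1 - delta)^2]. With the maximal residual at most the distance, [c <= 1] keeps the
   radicands nonnegative, so squaring the roots restores them. *)
have c_le1 : c <= 1 by have := sqr_ge0 (1 - delta); rewrite /c; lra.
rewrite mulrC -[X in _ <= X * _]ger0_norm // -sqrtr_sqr -sqrtrM ?sqr_ge0 //.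
set f := fun S => _.
have f_ge0 S : 0 <= f S by exact: sqrtr_ge0.
apply: (@le_trans _ _ (Num.sqrt (sample_mean beta f ^+ 2))).
  by rewrite sqrtr_sqr ger0_norm ?sample_mean_ge0.
apply: ler_wsqrtr; apply: le_trans (sqr_sample_mean_le beta_m _) _.
apply: (@le_trans _ _ (sample_mean beta
    (fun S => dist x P ^+ 2 + (- c) * max_residual x S ^+ 2))).
  apply: le_sample_mean => S _; rewrite sqr_sqrtr ?mulNr // subr_ge0.
  have : max_residual x S ^+ 2 <= dist x P ^+ 2.
    by rewrite ler_pXn2r ?nnegrE ?max_residual_ge0 ?max_residual_le_dist.
  have := sqr_ge0 (max_residual x S); nra.
rewrite sample_meanD sample_mean_cst // sample_meanZ.
have [L_gt0 /(_ x)] := hL; rewrite -/P => hLx.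
have b0 : (0 < beta)%N by case/andP: beta_m.
have : m%:R^-1 * l2norm (residual_pos A b x) ^+ 2 <=
    sample_mean beta (fun S => max_residual x S ^+ 2).
  have b0' : 0 < beta%:R :> R by rewrite ltr0n.
  rewrite -(ler_pM2l b0') mulrA -sum_residual -(@sample_mean_sum _ _ beta) //.
  by rewrite -sample_meanZ; apply: le_sample_mean => S; exact: max_residual_sqr_ge.
have m0 : 0 < m%:R :> R by rewrite ltr0n.
have : mu1 m L * dist x P ^+ 2 <= m%:R^-1 * l2norm (residual_pos A b x) ^+ 2.
  rewrite /mu1 invfM -mulrA ler_pM2l ?invr_gt0 // ler_pdivrMl //.
  by rewrite exprn_gt0.
move=> h1 h2; rewrite /hdelta -/c; have := le_trans h1 h2; nra.
Qed.

End SampleBounds.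

(** * Almost sure convergence from summable expected increments *)

Section AlmostSureConvergence.
Context {R : realType} {d : measure_display} {T : measurableType d}.
Variables (Pr : probability T R) (n : nat) (y : nat -> T -> 'cV[R]_n).

(** Each coordinate is a telescoping series that converges absolutely by comparison with the
    norms. *)
Lemma cvgn_l2norm_series (x : nat -> 'cV[R]_n) :
  cvgn (series (fun k => l2norm (x k.+1 - x k))) -> cvgn x.
Proof.
move=> cx; have cx_coord i : cvgn (fun k => x k i 0).
  have : cvgn (series (telescope (fun k => x k i 0))).
    apply: normed_cvg.
    have coord_le k : `|telescope (fun k => x k i 0) k| <= l2norm (x k.+1 - x k).
      by have := ler_l2norm_coord (x k.+1 - x k) i; rewrite !mxE.
    exact: (series_le_cvg (fun=> normr_ge0 _) (fun=> l2norm_ge0 _) coord_le cx).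
  rewrite telescopeK => cs.
  have -> : (fun k => x k i 0) =
      cst (x 0%N i 0) \+ (fun k => x k i 0 - x 0%N i 0).
    by apply/funext => k /=; rewrite addrC subrK.
  exact: is_cvgD (is_cvg_cst _) cs.
(* A neighbourhood of the limit contains a product of coordinate neighbourhoods, and there are
   finitely many coordinates. *)
apply/cvg_ex; exists (\col_i limn (fun k => x k i 0)) => U [V nV sVU].
have nearV i : \forall k \near \oo, V i 0 (x k i 0).
  by have := nV i 0; rewrite mxE => /(cx_coord i).
near=> k; apply: sVU => i j; rewrite (ord1 j); move: i; near: k.
exact: filter_forall nearV.
Unshelve. all: by end_near. Qed.

(** Summing under the integral bounds the expected total length by [M], so the total length is
    finite almost everywhere. *)
Lemma ae_cvg_summable (v : nat -> R) (M : R) :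
  (forall k, measurable_fun setT (fun w => l2norm (y k.+1 w - y k w))) ->
  (forall k, ('E_Pr[fun w => l2norm (y k.+1 w - y k w)] <= (v k)%:E)%E) ->
  (forall N, \sum_(k < N) v k <= M) ->
  {ae Pr, forall w, cvg (y k w @[k --> \oo])}.
Proof.
move=> mz Ez vM; pose f k w := (l2norm (y k.+1 w - y k w))%:E.
have f_ge0 k w : (0 <= f k w)%E by rewrite lee_fin l2norm_ge0.
have mf k : measurable_fun setT (f k) by exact/measurable_EFinP.
have If : Pr.-integrable setT (fun w => \sum_(0 <= k <oo) f k w)%E.
  apply/integrableP; split.
    by apply: (@ge0_emeasurable_sum _ _ _ _ _ xpredT) => // k w.
  under eq_integral do rewrite gee0_abs ?nneseries_ge0//.
  rewrite integral_nneseries //; apply: (@le_lt_trans _ _ M%:E); last exact: ltry.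
  apply: lime_le; first by apply: is_cvg_nneseries => k _ _; exact: integral_ge0.
  apply: nearW => N; rewrite big_mkord.
  apply: (@le_trans _ _ (\sum_(k < N) (v k)%:E)%E); last by rewrite sumEFin lee_fin.
  by apply: lee_sum => k _; have := Ez k; rewrite unlock.
apply: filterS (integrable_ae measurableT If) => w /(_ Logic.I) fin_w.
apply: cvgn_l2norm_series; apply: nondecreasing_is_cvgn.
  by apply: nondecreasing_series => k _ _; exact: l2norm_ge0.
exists (fine (\sum_(0 <= k <oo) f k w)%E) => _ [N _ <-].
rewrite -lee_fin fineK // /series /= -sumEFin.
by apply: (@nneseries_lim_ge R (f ^~ w) xpredT) => k _ _; exact: f_ge0.
Qed.

End AlmostSureConvergence.

(** * Random variables with values in a finite type *)

Section FiniteLaw.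
Context {R : realType} {d : measure_display} {T : measurableType d}.
Variables (Pr : probability T R) (F : finType) (Y : T -> F).
Hypothesis mY : forall y, measurable [set w | Y w = y].

Definition law (y : F) : R := fine (Pr [set w | Y w = y]).

Lemma law_ge0 y : 0 <= law y. Proof. by rewrite fine_ge0. Qed.

Lemma lawE y : Pr [set w | Y w = y] = (law y)%:E.
Proof. by rewrite fineK // fin_num_measure. Qed.

Lemma finite_valuedE (g : F -> R) w :
  g (Y w) = \sum_y g y * \1_[set w | Y w = y] w.
Proof.
rewrite (bigD1 (Y w)) //= big1 => [|y yw]; rewrite indicE.
  by rewrite mem_set // mulr1 addr0.
rewrite memNset ?mulr0 // => /= /eqP; rewrite eq_sym; exact/negP.
Qed.

Lemma measurable_finite_valued (g : F -> R) :
  measurable_fun setT (fun w => g (Y w)).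
Proof.
under eq_fun do rewrite finite_valuedE.
by apply: measurable_sum => y; apply: measurable_funM.
Qed.

Lemma expectation_finite_valued (g : F -> R) : (forall y, 0 <= g y) ->
  ('E_Pr[fun w => g (Y w)] = (\sum_y law y * g y)%:E)%E.
Proof.
move=> g_ge0; rewrite unlock.
under eq_integral do rewrite finite_valuedE -sumEFin.
rewrite ge0_integral_sum //.
- rewrite -sumEFin; apply: eq_bigr => y _.
  under eq_integral do rewrite EFinM.
  rewrite ge0_integralZl_EFin //; last by apply/measurable_EFinP/measurable_indic.
  by rewrite integral_indic // setIT [X in (_ * X)%E](lawE y) -EFinM mulrC.
- by move=> y; apply/measurable_EFinP; apply: measurable_funM.
- by move=> y w _; rewrite lee_fin mulr_ge0.
Qed.

End FiniteLaw.

(** * Joint law of the past and the fresh sample *)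

Section History.
Context {R : realType} {d : measure_display} {T : measurableType d}.
Variables (Pr : probability T R) (m beta : nat).
Variables (tau : nat -> T -> {set 'I_m}) (istar : nat -> T -> 'I_m).
Hypothesis us : uniform_sampling Pr beta tau istar.
Hypothesis m_gt0 : (0 < m)%N.

Definition past k w : k.-tuple ({set 'I_m} * 'I_m) :=
  [tuple (tau i.+1 w, istar i.+1 w) | i < k].

Let i0 := Ordinal m_gt0.

(** Links tuples to the events in the independence hypothesis. Step [l] sits at position [l.-1], and
    the default of [nth] is never read for [1 <= l <= k]. *)
Lemma past_eq_history k (y : k.-tuple ({set 'I_m} * 'I_m)) :
  [set w | past k w = y] =
  history tau istar k.+1 (fun l => (nth (finset.set0, i0) y l.-1).1)
    (fun l => (nth (finset.set0, i0) y l.-1).2).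
Proof.
apply/seteqP; split => w /= => [<- [//|l] /= lk|h].
  by rewrite (nth_mktuple _ _ (Ordinal (lk : l < k)%N)).
apply: eq_from_tnth => i; rewrite tnth_mktuple.
have [-> ->] := h i.+1 (ltn_ord i : (1 <= i.+1 < k.+1)%N).
by rewrite /= (tnth_nth (finset.set0, i0)); case: (nth _ _ _).
Qed.

Lemma measurable_history k S s : measurable (history tau istar k S s).
Proof.
(* For [k = 0] and [k = 1] no step is prescribed and the event is the whole space. *)
elim: k => [|[|k] IHk].
- rewrite (_ : history _ _ _ _ _ = setT) //.
  by apply/seteqP; split => // w _ l; rewrite ltn0 andbF.
- rewrite (_ : history _ _ _ _ _ = setT) //.
  by apply/seteqP; split => // w _ [|l].
- rewrite (_ : history _ _ _ _ _ = history tau istar k.+1 S s `&`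
     ([set w | tau k.+1 w = S k.+1] `&` [set w | istar k.+1 w = s k.+1])).
    apply: measurableI => //; apply: measurableI.
      exact: (measurable_sample us).
    exact: (measurable_index us).
  apply/seteqP; split => w /=.
    move=> h; split; last by have [] := h k.+1 (leqnn _).
    by move=> l /andP[l1 lk]; apply: h; rewrite l1 ltnS ltnW.
  move=> [h [hS hs]] l /andP[l1]; rewrite ltnS leq_eqVlt => /predU1P[->//|lk].
  by apply: h; rewrite l1.
Qed.

Lemma measurable_past k y : measurable [set w | past k w = y].
Proof. by rewrite past_eq_history; exact: measurable_history. Qed.

Lemma law_sample k S : (1 <= k)%N ->
  law Pr (tau k) S = if #|S| == beta then ('C(m, beta))%:R^-1 else 0.
Proof.
move=> k1; rewrite /law; case: eqP => [Sb|Sb].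
  by rewrite (uniform_sample us).
rewrite (_ : mkset _ = set0) ?measure0 //.
by apply/seteqP; split => // w /= wS; apply: Sb; rewrite -wS (card_sample us).
Qed.

Lemma law_past_sample k y S :
  law Pr (fun w => (past k w, tau k.+1 w)) (y, S) =
  law Pr (past k) y * law Pr (tau k.+1) S.
Proof.
rewrite /law [in RHS]mulrC -fineM ?fin_num_measure //.
- rewrite past_eq_history -(independent_sample us) // -past_eq_history.
  congr (fine (Pr _)); apply/seteqP; split => w /=; first by case=> -> ->.
  by case=> -> ->.
- exact: (measurable_sample us).
- exact: measurable_past.
Qed.

Lemma measurable_past_sample k z :
  measurable [set w | (past k w, tau k.+1 w) = z].
Proof.
case: z => y S.
rewrite (_ : mkset _ = [set w | past k w = y] `&` [set w | tau k.+1 w = S]).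
  by apply: measurableI; [exact: measurable_past|exact: (measurable_sample us)].
by apply/seteqP; split => w /= [-> ->].
Qed.

(** Plays the role of conditioning on the past: the joint law is a product, and the uniform law of
    the fresh sample turns the inner sum into [sample_mean]. *)
Lemma expectation_past_sample k (g : _ -> _ -> R) : (forall y S, 0 <= g y S) ->
  ('E_Pr[fun w => g (past k w) (tau k.+1 w)] =
  (\sum_y law Pr (past k) y * sample_mean beta (g y))%:E)%E.
Proof.
move=> g_ge0.
rewrite (@expectation_finite_valued _ _ _ Pr _ _ (@measurable_past_sample k)
  (fun z => g z.1 z.2)) //.
congr EFin.
transitivity (\sum_y \sum_S law Pr (fun w => (past k w, tau k.+1 w)) (y, S) * g y S).
  by rewrite pair_bigA; apply: eq_bigr => -[].
apply: eq_bigr => y _; rewrite /sample_mean mulr_sumr mulr_sumr.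
rewrite [RHS]big_mkcond; apply: eq_bigr => S _.
rewrite law_past_sample law_sample //; case: ifP => _; last by rewrite mulr0 mul0r.
by rewrite mulrA.
Qed.

End History.

(** * The coupled recursion for the expected distance and the expected move *)

Section Iterates.
Context {R : realType} {d : measure_display} {T : measurableType d}.
Variables (Pr : probability T R) (m n : nat) (A : 'M[R]_(m, n)) (b : 'cV[R]_m).
Variables (beta : nat) (L delta gamma : R).
Variables (tau : nat -> T -> {set 'I_m}) (istar : nat -> T -> 'I_m).
Variables (x0 : 'cV[R]_n) (x : nat -> T -> 'cV[R]_n).
Hypothesis unit_row : forall i, l2norm (row i A)^T = 1.
Let P := polyhedron A b.
Hypothesis P0 : P !=set0.
Hypothesis beta_m : (1 <= beta <= m)%N.
Hypothesis hL : hoffman_constant A b L.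
Hypothesis us : uniform_sampling Pr beta tau istar.
Hypothesis xP : mskm A b delta gamma x0 tau istar x.
Hypothesis delta02 : 0 < delta < 2.
Hypothesis gamma_ge0 : 0 <= gamma.

Let m_gt0 : (0 < m)%N.
Proof. by case/andP: beta_m; exact: leq_trans. Qed.

Definition mskm_next (p : 'cV[R]_n * 'cV[R]_n) (i : 'I_m) :=
  (p.1 - (delta * residual_pos A b p.1 i 0) *: (row i A)^T
     + gamma *: (p.1 - p.2), p.1).

(** Replays the algorithm from a recorded past, so that the iterates become functions of finite
    data. The pair holds the current and previous iterates, which momentum requires; both start at
    [x0] because [x_1 = x_0]. *)
Definition mskm_state (y : seq ({set 'I_m} * 'I_m)) :=
  foldl (fun p e => mskm_next p e.2) (x0, x0) y.

Lemma past_rcons k w :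
  past tau istar k.+1 w = rcons (past tau istar k w) (tau k.+1 w, istar k.+1 w) :> seq _.
Proof.
have pastE j :
    past tau istar j w = [seq (tau l.+1 w, istar l.+1 w) | l <- iota 0 j] :> seq _.
  by rewrite /= -val_enum_ord -map_comp.
by rewrite !pastE -[in LHS]addn1 iotaD map_cat cats1.
Qed.

Lemma mskm_state_past k w : mskm_state (past tau istar k w) = (x k.+1 w, x k w).
Proof.
elim: k => [|k IHk].
  by rewrite /mskm_state tuple0 /= (mskm_start1 xP) (mskm_start0 xP).
rewrite past_rcons /mskm_state foldl_rcons -/(mskm_state _) IHk /mskm_next /=.
by rewrite (mskm_step xP w (ltn0Sn k)).
Qed.

(** A real finite sum, to keep the recursion out of the extended reals; [expectation_dist]
    identifies it with the expectation at iterate [k.+1]. *)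
Definition mean_dist k : R :=
  \sum_y law Pr (past tau istar k) y * dist (mskm_state y).1 P.

Definition mean_move k : R :=
  \sum_y law Pr (past tau istar k) y * l2norm ((mskm_state y).1 - (mskm_state y).2).

Lemma mean_dist_ge0 k : 0 <= mean_dist k.
Proof. by apply: sumr_ge0 => y _; rewrite mulr_ge0 ?law_ge0 ?dist_ge0. Qed.

Lemma mean_move_ge0 k : 0 <= mean_move k.
Proof. by apply: sumr_ge0 => y _; rewrite mulr_ge0 ?law_ge0 ?l2norm_ge0. Qed.

Let distE k : (fun w => dist (x k.+1 w) P) =
  (fun w => dist (mskm_state (past tau istar k w)).1 P).
Proof. by apply/funext => w; rewrite mskm_state_past. Qed.

Let moveE k : (fun w => l2norm (x k.+1 w - x k w)) =
  (fun w => l2norm ((mskm_state (past tau istar k w)).1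
                    - (mskm_state (past tau istar k w)).2)).
Proof. by apply/funext => w; rewrite mskm_state_past. Qed.

Lemma measurable_dist k : measurable_fun setT (fun w => dist (x k.+1 w) P).
Proof.
rewrite distE.
exact: (measurable_finite_valued (measurable_past us m_gt0 (k := k))
  (fun y => dist (mskm_state y).1 P)).
Qed.

Lemma measurable_move k : measurable_fun setT (fun w => l2norm (x k.+1 w - x k w)).
Proof.
rewrite moveE.
exact: (measurable_finite_valued (measurable_past us m_gt0 (k := k))
  (fun y => l2norm ((mskm_state y).1 - (mskm_state y).2))).
Qed.

Lemma expectation_dist k : ('E_Pr[fun w => dist (x k.+1 w) P] = (mean_dist k)%:E)%E.
Proof.
rewrite distE (expectation_finite_valued Pr (measurable_past us m_gt0 (k := k))
  (g := fun y => dist (mskm_state y).1 P)) // => y.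
exact: dist_ge0.
Qed.

Lemma expectation_move k :
  ('E_Pr[fun w => l2norm (x k.+1 w - x k w)] = (mean_move k)%:E)%E.
Proof.
rewrite moveE (expectation_finite_valued Pr (measurable_past us m_gt0 (k := k))
  (g := fun y => l2norm ((mskm_state y).1 - (mskm_state y).2))) // => y.
exact: l2norm_ge0.
Qed.

Lemma mean_dist0 : mean_dist 0 = dist x0 P.
Proof.
apply: EFin_inj; rewrite -expectation_dist -[RHS](expectation_cst Pr).
by congr expectation; apply/funext => w; rewrite (mskm_start1 xP).
Qed.

Lemma mean_move0 : mean_move 0 = 0.
Proof.
apply: EFin_inj; rewrite -expectation_move -[RHS](expectation_cst Pr).
congr expectation; apply/funext => w.
by rewrite (mskm_start1 xP) (mskm_start0 xP) subrr l2norm0.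
Qed.

Lemma residual_istarE k w : (1 <= k)%N ->
  residual_pos A b (x k w) (istar k w) 0 = max_residual A b (x k w) (tau k w).
Proof.
move=> k1; apply/esym/max_residual_argmax; first exact: (mskm_index xP).
by move=> j; exact: (mskm_argmax xP).
Qed.

(** The new iterate also depends on the selected index, about which independence says nothing; [f]
    is therefore first bounded by a function of the past and the sample alone. *)
Lemma expectation_le_past_sample k (f : T -> R)
    (g : k.-tuple ({set 'I_m} * 'I_m) -> {set 'I_m} -> R) :
  measurable_fun setT f -> (forall w, 0 <= f w) -> (forall y S, 0 <= g y S) ->
  (forall w, f w <= g (past tau istar k w) (tau k.+1 w)) ->
  ('E_Pr[f] <= (\sum_y law Pr (past tau istar k) y * sample_mean beta (g y))%:E)%E.
Proof.
move=> mf f_ge0 g_ge0 fg; rewrite -(expectation_past_sample us m_gt0) //.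
apply: expectation_le => //; last exact: nearW.
exact: (measurable_finite_valued (@measurable_past_sample _ _ _ _ _ _ _ _ us m_gt0 k)
  (fun z => g z.1 z.2)).
Qed.

Lemma mean_dist_step k :
  mean_dist k.+1 <= Num.sqrt (hdelta m L delta) * mean_dist k + gamma * mean_move k.
Proof.
have [d0 d2] := andP delta02.
(* The root is the bound from [dist_step], with the selected residual written as a sample maximum;
   the second term is the cost of momentum. *)
pose g (y : k.-tuple ({set 'I_m} * 'I_m)) S :=
  Num.sqrt (dist (mskm_state y).1 P ^+ 2
    - (2 * delta - delta ^+ 2) * max_residual A b (mskm_state y).1 S ^+ 2)
  + gamma * l2norm ((mskm_state y).1 - (mskm_state y).2).
rewrite -lee_fin -expectation_dist.
apply: (le_trans (expectation_le_past_sample (k := k) (g := g) _ _ _ _)).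
- exact: measurable_dist.
- by move=> w; exact: dist_ge0.
- by move=> y S; rewrite addr_ge0 ?sqrtr_ge0 ?mulr_ge0 ?l2norm_ge0.
- move=> w; rewrite /g mskm_state_past /= (mskm_step xP w (ltn0Sn k)) /=.
  apply: le_trans (distD P0 _ _) _.
  rewrite l2normZ (ger0_norm gamma_ge0) lerD2r.
  rewrite -[leLHS]ger0_norm ?dist_ge0 // -sqrtr_sqr ler_wsqrtr //.
  by rewrite lerBrDr -residual_istarE //; exact: dist_step.
rewrite lee_fin !mulr_sumr -big_split /=; apply: ler_sum => y _.
rewrite !(mulrCA _ (law _ _ _)) -mulrDr ler_wpM2l ?law_ge0 //.
rewrite sample_meanD sample_mean_cst // lerD2r.
exact: sample_mean_dist_le.
Qed.

Lemma mean_move_step k :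
  mean_move k.+1 <=
    delta * Num.sqrt (mu2 A beta) * mean_dist k + gamma * mean_move k.
Proof.
have [d0 d2] := andP delta02.
pose g (y : k.-tuple ({set 'I_m} * 'I_m)) S :=
  delta * max_residual A b (mskm_state y).1 S
  + gamma * l2norm ((mskm_state y).1 - (mskm_state y).2).
rewrite -lee_fin -expectation_move.
apply: (le_trans (expectation_le_past_sample (k := k) (g := g) _ _ _ _)).
- exact: measurable_move.
- by move=> w; exact: l2norm_ge0.
- by move=> y S; rewrite addr_ge0 ?mulr_ge0 ?l2norm_ge0 ?max_residual_ge0 ?(ltW d0).
- move=> w; rewrite /g mskm_state_past /= (mskm_step xP w (ltn0Sn k)) /=.
  rewrite -residual_istarE // addrAC [X in X + _]addrAC subrr add0r.
  apply: le_trans (l2normD _ _) _; rewrite -scaleNr !l2normZ unit_row mulr1.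
  by rewrite (ger0_norm gamma_ge0) normrN ger0_norm // mulr_ge0 ?residual_ge0 ?(ltW d0).
rewrite lee_fin !mulr_sumr -big_split /=; apply: ler_sum => y _.
rewrite !(mulrCA _ (law _ _ _)) -mulrDr ler_wpM2l ?law_ge0 //.
rewrite sample_meanD sample_mean_cst // lerD2r sample_meanZ -mulrA ler_pM2l //.
exact: sample_mean_residual_le.
Qed.

End Iterates.

(** * The two-dimensional linear recursion and its closed form *)

Section Recursion.
Context {R : realType}.
Variables (a g c : R).
Hypotheses (a_ge0 : 0 <= a) (a_lt1 : a < 1) (g_ge0 : 0 <= g) (g_lt1 : g < 1).
Hypothesis c_gt0 : 0 < c.
Hypothesis stable : g * c < (1 - a) * (1 - g).
Let D := (a - g) ^+ 2 + 4 * g * c.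
Let s : R := Num.sqrt D.
Let Gamma1 := (a - g + s) / (2 * c).
Let Gamma2 := (a - g - s) / (2 * c).
Let Gamma3 := c / s.
Let rho1 := 2^-1 * (a + g - s).
Let rho2 := 2^-1 * (a + g + s).

Lemma discr_ge0 : 0 <= D.
Proof. by rewrite addr_ge0 ?sqr_ge0 ?mulr_ge0 ?(ltW c_gt0). Qed.

Let ss : s ^+ 2 = D. Proof. exact: sqr_sqrtr discr_ge0. Qed.
Let s_ge0 : 0 <= s. Proof. exact: sqrtr_ge0. Qed.

(** [rho2 - rho1 = s] and [rho1 + rho2 = a + g] are both nonnegative. *)
Lemma norm_rho1_le : `|rho1| <= rho2.
Proof.
have [a0 [g0 s0]] := (a_ge0, (g_ge0, s_ge0)).
have lo : - rho2 <= rho1 by rewrite /rho1 /rho2; lra.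
have hi : rho1 <= rho2 by rewrite /rho1 /rho2; lra.
by rewrite ler_norml lo hi.
Qed.

(** The claim amounts to [s < 2 - a - g], and [(2 - a - g)^2 - D = 4 ((1 - a)(1 - g) - g c)] is
    positive by [stable]. *)
Lemma rho2_lt1 : rho2 < 1.
Proof.
have [a1 [g1 st]] := (a_lt1, (g_lt1, stable)).
suff : s < 2 - a - g by rewrite /rho2; lra.
rewrite -(ltr_pXn2r (n := 2)) ?nnegrE //; last by lra.
by rewrite ss /D; lra.
Qed.

Section Sequences.
Variables (d0 : R) (u v : nat -> R).
Hypothesis d0_ge0 : 0 <= d0.
Hypotheses (u_ge0 : forall k, 0 <= u k) (v_ge0 : forall k, 0 <= v k).
Hypotheses (u0 : u 0%N = d0) (v0 : v 0%N = 0).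
Hypothesis u_step : forall k, u k.+1 <= a * u k + g * v k.
Hypothesis v_step : forall k, v k.+1 <= c * u k + g * v k.

(** [(Gamma_i, 1)] is an eigenvector for [rho_i], and since [Gamma1 - Gamma2 = 1 / Gamma3], the
    start [(d0, 0)] is [d0 Gamma3] times the difference of the two eigenvectors. Nonnegative
    coefficients let the bounds pass through the induction. *)
Lemma recursion_bound k : D != 0 ->
  u k <= (- Gamma2 * Gamma3 * rho1 ^+ k + Gamma1 * Gamma3 * rho2 ^+ k) * d0 /\
  v k <= (- Gamma3 * rho1 ^+ k + Gamma3 * rho2 ^+ k) * d0.
Proof.
rewrite -ss sqrf_eq0 => s0; have c0 : c != 0 by rewrite gt_eqF.
have g2 : Gamma2 * rho1 = a * Gamma2 + g.
  (* This feeds the relation [s^2 = D] to [field]: with [Gamma2] and [rho1] still folded, only the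
     isolated [g] is replaced. *)
  have -> : g = (s ^+ 2 - (a - g) ^+ 2) / (4 * c) by rewrite ss /D; field.
  by rewrite /Gamma2 /rho1; field.
have g1 : Gamma1 * rho2 = a * Gamma1 + g.
  have -> : g = (s ^+ 2 - (a - g) ^+ 2) / (4 * c) by rewrite ss /D; field.
  by rewrite /Gamma1 /rho2; field.
have r1 : rho1 = c * Gamma2 + g by rewrite /Gamma2 /rho1; field.
have r2 : rho2 = c * Gamma1 + g by rewrite /Gamma1 /rho2; field.
elim: k => [|k [IHu IHv]].
  rewrite !expr0 !mulr1 u0 v0 addNr mul0r; split => //.
  suff -> : - Gamma2 * Gamma3 + Gamma1 * Gamma3 = 1 by rewrite mul1r.
  by rewrite /Gamma1 /Gamma2 /Gamma3; field; rewrite s0 c0.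
split.
  apply: le_trans (u_step k) _.
  apply: le_trans (lerD (ler_wpM2l a_ge0 IHu) (ler_wpM2l g_ge0 IHv)) _.
  rewrite le_eqVlt; apply/orP; left; apply/eqP; rewrite !exprS.
  transitivity ((- (Gamma2 * rho1) * Gamma3 * rho1 ^+ k
                 + Gamma1 * rho2 * Gamma3 * rho2 ^+ k) * d0); last by ring.
  by rewrite g1 g2; ring.
apply: le_trans (v_step k) _.
apply: le_trans (lerD (ler_wpM2l (ltW c_gt0) IHu) (ler_wpM2l g_ge0 IHv)) _.
rewrite le_eqVlt; apply/orP; left; apply/eqP; rewrite !exprS.
rewrite [X in _ = (- Gamma3 * (X * _) + _) * _]r1.
by rewrite [X in _ = (_ + Gamma3 * (X * _)) * _]r2; ring.
Qed.

(** The two weights sum to 1 and the one on [rho1 ^+ k] is nonnegative, because [s >= |a - g|]; so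
    [rho1 ^+ k] may be raised to [rho2 ^+ k]. *)
Lemma closed_form_le k : D != 0 ->
  - Gamma2 * Gamma3 * rho1 ^+ k + Gamma1 * Gamma3 * rho2 ^+ k <= rho2 ^+ k.
Proof.
rewrite -ss sqrf_eq0 => s0; have c0 : c != 0 by rewrite gt_eqF.
have rk : rho1 ^+ k <= rho2 ^+ k.
  apply: le_trans (ler_norm _) _; rewrite normrX lerXn2r ?nnegrE //.
    exact: le_trans (normr_ge0 _) norm_rho1_le.
  exact: norm_rho1_le.
have g23 : 0 <= - Gamma2 * Gamma3.
  have -> : - Gamma2 * Gamma3 = (s - (a - g)) / (2 * s).
    by rewrite /Gamma2 /Gamma3; field; rewrite s0 c0.
  rewrite divr_ge0 ?mulr_ge0 // subr_ge0.
  apply: le_trans (ler_norm _) _; rewrite -sqrtr_sqr ler_wsqrtr //.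
  by rewrite /D lerDl !mulr_ge0 ?(ltW c_gt0).
have -> : Gamma1 * Gamma3 = 1 - - Gamma2 * Gamma3.
  by rewrite /Gamma1 /Gamma2 /Gamma3; field; rewrite s0 c0.
have := ler_wpM2l g23 rk; lra.
Qed.

Lemma recursion_geometric k : u k <= rho2 ^+ k * d0.
Proof.
have [Dz|Dn0] := eqVneq D 0; last first.
  have [uk _] := recursion_bound k Dn0; apply: le_trans uk _.
  by rewrite ler_wpM2r // closed_form_le.
case: k => [|k]; first by rewrite expr0 mul1r u0.
(* [D = 0] is a sum of two nonnegative terms, so both vanish; then [a = g = 0] and every [u k.+1] is
   at most 0. *)
have [ag gc] : (a - g) ^+ 2 = 0 /\ g * c = 0.
  have := sqr_ge0 (a - g); have := mulr_ge0 g_ge0 (ltW c_gt0).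
  by move: Dz; rewrite /D => ? ? ?; split; lra.
have g0 : g = 0 by move/eqP: gc; rewrite mulf_eq0 (gt_eqF c_gt0) orbF => /eqP.
have a0 : a = 0 by move/eqP: ag; rewrite g0 subr0 sqrf_eq0 => /eqP.
apply: (@le_trans _ _ 0).
  by have := u_step k; rewrite {1}a0 g0 !mul0r addr0.
rewrite mulr_ge0 ?exprn_ge0 //.
exact: le_trans (normr_ge0 _) norm_rho1_le.
Qed.

(** Summing both recursions gives [U <= d0 + a U + g V] and [V <= c U + g V]; adding [c] times the
    first to [1 - a] times the second eliminates [U]. This covers [D = 0] as well. *)
Lemma recursion_summable N : \sum_(k < N) v k <= c * d0 / ((1 - a) * (1 - g) - g * c).
Proof.
set U := \sum_(k < N) u k; set V := \sum_(k < N) v k.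
have Ule : U <= d0 + a * U + g * V.
  apply: (@le_trans _ _ (\sum_(k < N.+1) u k)); first by rewrite big_ord_recr lerDl.
  rewrite big_ord_recl u0 -addrA lerD2l !mulr_sumr -big_split /=.
  by apply: ler_sum => k _; exact: u_step.
have Vle : V <= c * U + g * V.
  apply: (@le_trans _ _ (\sum_(k < N.+1) v k)); first by rewrite big_ord_recr lerDl.
  rewrite big_ord_recl v0 add0r !mulr_sumr -big_split /=.
  by apply: ler_sum => k _; exact: v_step.
have kappa : 0 < (1 - a) * (1 - g) - g * c by rewrite subr_gt0.
rewrite ler_pdivlMr //.
have a1 : 0 <= 1 - a by rewrite subr_ge0 ltW.
have h1 : (1 - a) * ((1 - g) * V) <= (1 - a) * (c * U) by rewrite ler_wpM2l //; lra.
have h2 : c * ((1 - a) * U) <= c * (d0 + g * V) by rewrite ler_pM2l //; lra.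
lra.
Qed.

End Sequences.
End Recursion.

Theorem theorem4p3 (R : realType) (m n : nat) (A : 'M[R]_(m, n)) (b : 'cV[R]_m)
  (beta : nat) (L delta gamma : R)
  (d : measure_display) (T : measurableType d) (Pr : probability T R)
  (tau : nat -> T -> {set 'I_m}) (istar : nat -> T -> 'I_m)
  (x0 : 'cV[R]_n) (x : nat -> T -> 'cV[R]_n) :
  (forall i, l2norm (row i A)^T = 1) ->
  polyhedron A b !=set0 ->
  (1 <= beta <= m)%N ->
  hoffman_constant A b L ->
  uniform_sampling Pr beta tau istar ->
  mskm A b delta gamma x0 tau istar x ->
  0 < delta < 2 ->
  0 <= gamma < 1 ->
  gamma < (1 - Num.sqrt (hdelta m L delta)) /
          (1 - Num.sqrt (hdelta m L delta) + delta * Num.sqrt (mu2 A beta)) ->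
  let P := polyhedron A b in
  let Pi1 := Num.sqrt (hdelta m L delta) in
  let Pi2 := gamma in
  let Pi3 := delta * Num.sqrt (mu2 A beta) in
  let Pi4 := gamma in
  let D := (Pi1 - Pi4) ^+ 2 + 4 * Pi2 * Pi3 in
  let Gamma1 := (Pi1 - Pi4 + Num.sqrt D) / (2 * Pi3) in
  let Gamma2 := (Pi1 - Pi4 - Num.sqrt D) / (2 * Pi3) in
  let Gamma3 := Pi3 / Num.sqrt D in
  let rho1 := 2^-1 * (Pi1 + Pi4 - Num.sqrt D) in
  let rho2 := 2^-1 * (Pi1 + Pi4 + Num.sqrt D) in
  [/\ {ae Pr, forall w, cvg (x k w @[k --> \oo])},
      (* the bounds involving Gamma3 = Pi3 / sqrt D are meaningful for D != 0 *)
      D != 0 -> forall k : nat,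
        [/\ ('E_Pr[fun w => dist (x k.+1 w) P] <=
               ((- Gamma2 * Gamma3 * rho1 ^+ k + Gamma1 * Gamma3 * rho2 ^+ k)
                 * dist x0 P)%:E)%E,
            (- Gamma2 * Gamma3 * rho1 ^+ k + Gamma1 * Gamma3 * rho2 ^+ k)
              * dist x0 P <= rho2 ^+ k * dist x0 P,
            ('E_Pr[fun w => l2norm (x k.+1 w - x k w)] <=
               ((- Gamma3 * rho1 ^+ k + Gamma3 * rho2 ^+ k)
                 * dist x0 P)%:E)%E &
            (- Gamma3 * rho1 ^+ k + Gamma3 * rho2 ^+ k) * dist x0 P
              <= 2 * Gamma3 * rho2 ^+ k * dist x0 P],
      (* the outer bound of the first chain is free of Gamma's, so it is also
         stated without D != 0 *)
      forall k : nat,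
        ('E_Pr[fun w => dist (x k.+1 w) P] <= (rho2 ^+ k * dist x0 P)%:E)%E,
      0 <= Gamma3 &
      0 <= `|rho1| <= rho2 /\ rho2 < 1].
Proof.
move=> unit_row P0 beta_m hL us xP delta02 /andP[gamma_ge0 gamma_lt1] gamma_lt P.
have [d0 d2] := andP delta02.
have m_gt0 : (0 < m)%N by case/andP: beta_m => ? /(leq_trans _); apply.
have [L_gt0 _] := hL.
set a := Num.sqrt (hdelta m L delta); set c := delta * Num.sqrt (mu2 A beta).
move=> Pi1 Pi2 Pi3 Pi4 D Gamma1 Gamma2 Gamma3 rho1 rho2.
have a_ge0 : 0 <= a by exact: sqrtr_ge0.
have a_lt1 : a < 1.
  rewrite -[ltRHS]sqrtr1 ltr_sqrt // /hdelta ltrBlDr ltrDl mulr_gt0 //.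
    by rewrite expr2 -mulrBl mulr_gt0 // subr_gt0.
  by rewrite invr_gt0 mulr_gt0 ?exprn_gt0 ?ltr0n.
have c_gt0 : 0 < c by rewrite mulr_gt0 // sqrtr_gt0; exact: mu2_gt0.
(* The assumed bound on [gamma], cleared of its denominator. *)
have stable : gamma * c < (1 - a) * (1 - gamma).
  move: gamma_lt; rewrite -/a -/c ltr_pdivlMr; last by rewrite addr_gt0 ?subr_gt0.
  lra.
pose u := mean_dist Pr A b delta gamma tau istar x0.
pose v := mean_move Pr A b delta gamma tau istar x0.
have u_ge0 : forall k, 0 <= u k by move=> k; exact: mean_dist_ge0.
have v_ge0 : forall k, 0 <= v k by move=> k; exact: mean_move_ge0.
have u0 : u 0%N = dist x0 P by exact: (mean_dist0 P0 beta_m us xP).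
have v0 : v 0%N = 0 by exact: (mean_move0 beta_m us xP).
have u_step k : u k.+1 <= a * u k + gamma * v k.
  exact: (mean_dist_step unit_row P0 beta_m hL us xP delta02 gamma_ge0).
have v_step k : v k.+1 <= c * u k + gamma * v k.
  exact: (mean_move_step unit_row P0 beta_m us xP delta02 gamma_ge0).
have Eu k : ('E_Pr[fun w => dist (x k.+1 w) P] = (u k)%:E)%E.
  exact: (expectation_dist P0 beta_m us xP).
have Ev k : ('E_Pr[fun w => l2norm (x k.+1 w - x k w)] = (v k)%:E)%E.
  exact: (expectation_move beta_m us xP).
have dist0 : 0 <= dist x0 P by exact: dist_ge0.
have r12 : `|rho1| <= rho2 := norm_rho1_le c a_ge0 gamma_ge0.
have rho2_ge0 : 0 <= rho2 := le_trans (normr_ge0 _) r12.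
(* If [D = 0], division by zero yields [Gamma3 = 0], which still satisfies the inequality. *)
have Gamma3_ge0 : 0 <= Gamma3 by rewrite divr_ge0 ?sqrtr_ge0 // ltW.
split=> [|Dn0 k|k||].
- apply: (@ae_cvg_summable _ _ _ Pr _ x v
    (c * dist x0 P / ((1 - a) * (1 - gamma) - gamma * c))).
  + by move=> k; exact: (measurable_move beta_m us xP).
  + by move=> k; rewrite Ev.
  + exact: (recursion_summable a_lt1 c_gt0 stable u_ge0 v_ge0 u0 v0 u_step v_step).
- have [bu bv] := recursion_bound a_ge0 gamma_ge0 c_gt0 u0 v0 u_step v_step k Dn0.
  split.
  + by rewrite Eu lee_fin.
  + by rewrite ler_wpM2r //; exact: closed_form_le.
  + by rewrite Ev lee_fin.
  (* [rho1] may be negative, so [- rho1 ^+ k] can be positive; bounding it by [rho2 ^+ k] produces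
     the factor 2. *)
  + have rk : - rho1 ^+ k <= rho2 ^+ k.
      apply: le_trans (ler_norm _) _.
      by rewrite normrN normrX lerXn2r ?nnegrE.
    rewrite ler_wpM2r //; have := ler_wpM2l Gamma3_ge0 rk; lra.
- rewrite Eu lee_fin.
  exact: (recursion_geometric a_ge0 gamma_ge0 c_gt0 dist0 u0 v0 u_step v_step).
- exact: Gamma3_ge0.
- by rewrite normr_ge0 r12; split => //; exact: rho2_lt1.
Qed.
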